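(* Let $G$ be an abelian group and let $A$ be a finite set with $|A|\ge 2$. Then the homomorphism $\Psi : \mathrm{Aut}(G)\to\mathrm{Out}(\mathrm{CA}(G;A))$ given by $\Psi(\phi) = \phi_{\mathrm{CA}}\,\mathrm{Inn}(\mathrm{CA}(G;A))$ is injective.
   Context: $A^G$ is the set of all functions $x : G \to A$, with the shift action $(g\cdot x)(h) := x(g^{-1}h)$ for $x \in A^G$, $g,h\in G$. $\mathrm{CA}(G;A)$ is the monoid, under composition, of all cellular automata over $A^G$, i.e. functions $\tau : A^G \to A^G$ for which there are a finite subset $S\subseteq G$ and a function $\mu : A^S\to A$ with $\tau(x)(g) = \mu((g^{-1}\cdot x)|_S)$ for all $x\in A^G$, $g \in G$. For $\phi\in\mathrm{Aut}(G)$, $\phi^\star : A^G\to A^G$ is $\phi^\star(x) := x\circ\phi$, and $\phi_{\mathrm{CA}}\in\mathrm{Aut}(\mathrm{CA}(G;A))$ is the automorphism $\phi_{\mathrm{CA}}(\tau) := (\phi^{-1})^\star\circ\tau\circ\phi^\star$. For a monoid $M$, an automorphism $\alpha$ of $M$ is inner if there is an invertible element $a\in M$ with $\alpha(x) = a^{-1}xa$ for all $x\in M$; $\mathrm{Inn}(M)$ is the set of inner automorphisms, a normal subgroup of $\mathrm{Aut}(M)$; and $\mathrm{Out}(M) := \mathrm{Aut}(M)/\mathrm{Inn}(M)$. *)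

(* Defs.v *)
From HB Require Import structures.
From mathcomp Require Import all_boot.
From mathcomp Require Import boolp.
From mathcomp Require Import finmap.

Set Implicit Arguments.
Unset Strict Implicit.
Unset Printing Implicit Defensive.

Local Open Scope group_scope.
Local Open Scope quotient_scope.

(* For a group M, a unital multiplicative bijection is the same thing as a
   group automorphism, so this single definition covers Aut(G) and
   Aut(CA(G; A)). *)
Record Aut (M : monoidType) := MkAut {
  aut_fun :> M -> M;
  aut_morph : monoid_morphism aut_fun;
  aut_bij : bijective aut_fun }.

Section AutGroup.
Variable M : monoidType.
Implicit Types a b c : Aut M.

HB.instance Definition _ := gen_eqMixin (Aut M).
HB.instance Definition _ := gen_choiceMixin (Aut M).

Lemma aut_eq a b : a =1 b -> a = b.
Proof.
case: a b => [f fM fB] [g gM gB] /= /funext fg.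
case: g / fg gM gB => gM gB; congr MkAut; exact: Prop_irrelevance.
Qed.

Lemma aut1 a : a 1 = 1. Proof. by case: (aut_morph a). Qed.

Lemma autM a : {morph a : x y / x * y}.
Proof. by case: (aut_morph a). Qed.

Lemma aut_inv_ex a : exists f : M -> M, cancel a f /\ cancel f a.
Proof. by case: (aut_bij a) => f; exists f. Qed.

Definition aut_inv_fun a : M -> M := sval (cid (aut_inv_ex a)).

Lemma aut_invK a : cancel a (aut_inv_fun a).
Proof. by rewrite /aut_inv_fun; case: cid => f []. Qed.

Lemma aut_Kinv a : cancel (aut_inv_fun a) a.
Proof. by rewrite /aut_inv_fun; case: cid => f []. Qed.

Lemma aut_id_morph : monoid_morphism (@id M). Proof. by []. Qed.

Lemma aut_id_bij : bijective (@id M). Proof. by exists id. Qed.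

Definition aut_one : Aut M := MkAut aut_id_morph aut_id_bij.

Lemma aut_comp_morph a b : monoid_morphism (a \o b).
Proof. by split=> [|x y] /=; rewrite ?aut1 ?autM. Qed.

Lemma aut_comp_bij a b : bijective (a \o b).
Proof. exact: bij_comp (aut_bij a) (aut_bij b). Qed.

Definition aut_mul a b : Aut M :=
  MkAut (aut_comp_morph a b) (aut_comp_bij a b).

Lemma aut_inv_morph a : monoid_morphism (aut_inv_fun a).
Proof.
split=> [|x y]; apply: (can_inj (aut_invK a)); first by rewrite aut_Kinv aut1.
by rewrite autM !aut_Kinv.
Qed.

Lemma aut_inv_bij a : bijective (aut_inv_fun a).
Proof. by exists a; [exact: aut_Kinv | exact: aut_invK]. Qed.

Definition aut_inv a : Aut M := MkAut (aut_inv_morph a) (aut_inv_bij a).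

Fact aut_mulA : associative aut_mul.
Proof. by move=> a b c; apply: aut_eq. Qed.

Fact aut_mul1 : left_id aut_one aut_mul.
Proof. by move=> a; apply: aut_eq. Qed.

Fact aut_1mul : right_id aut_one aut_mul.
Proof. by move=> a; apply: aut_eq. Qed.

Fact aut_mulV : left_inverse aut_one aut_inv aut_mul.
Proof. by move=> a; apply: aut_eq => x /=; rewrite aut_invK. Qed.

Fact aut_Vmul : right_inverse aut_one aut_inv aut_mul.
Proof. by move=> a; apply: aut_eq => x /=; rewrite aut_Kinv. Qed.

HB.instance Definition _ := isGroup.Build (Aut M)
  aut_mulA aut_mul1 aut_1mul aut_mulV aut_Vmul.

Lemma autME a b x : (a * b) x = a (b x). Proof. by []. Qed.

Lemma autVK a x : a^-1 (a x) = x. Proof. exact: aut_invK. Qed.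

Lemma autKV a x : a (a^-1 x) = x. Proof. exact: aut_Kinv. Qed.

(* The element v is the inverse of the invertible element u. *)
Definition inner a : Prop :=
  exists u v : M, [/\ u * v = 1, v * u = 1 & forall x, a x = v * x * u].

Lemma inner1 : inner 1.
Proof. by exists 1, 1; split; rewrite ?mulg1 // => x; rewrite mul1g mulg1. Qed.

Lemma innerM a b : inner a -> inner b -> inner (a * b).
Proof.
move=> [u [v [uv vu aE]]] [u' [v' [uv' vu' bE]]].
exists (u' * u), (v * v'); split=> [||x].
- by rewrite mulgA -(mulgA u') uv mulg1 uv'.
- by rewrite mulgA -(mulgA v) vu' mulg1 vu.
- by rewrite autME bE aE !mulgA.
Qed.

Lemma innerV a : inner a -> inner a^-1.
Proof.
move=> [u [v [uv vu aE]]]; exists v, u; split=> // x.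
by apply: (can_inj (autVK a)); rewrite autKV aE !mulgA vu mul1g -mulgA vu mulg1.
Qed.

Lemma innerJ a b : inner a -> inner (b^-1 * a * b).
Proof.
move=> [u [v [uv vu aE]]]; exists (b^-1 u), (b^-1 v); split=> [||x].
- by rewrite -autM uv aut1.
- by rewrite -autM vu aut1.
- by rewrite !autME aE !autM autVK.
Qed.

(* a Inn(M) = b Inn(M) as left cosets. *)
Definition inn_rel : rel (Aut M) := fun a b => `[< inner (a^-1 * b) >].

Fact inn_refl : reflexive inn_rel.
Proof. by move=> a; apply/asboolP; rewrite mulVg; exact: inner1. Qed.

Fact inn_sym : symmetric inn_rel.
Proof.
by move=> a b; apply/asboolP/asboolP => /innerV; rewrite invgM invgK.
Qed.

Fact inn_trans : transitive inn_rel.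
Proof.
move=> b a c /asboolP ab /asboolP bc; apply/asboolP.
by have := innerM ab bc; rewrite mulgA mulgK.
Qed.

Canonical inn_equiv := EquivRel inn_rel inn_refl inn_sym inn_trans.

Definition Out := {eq_quot inn_equiv}.

HB.instance Definition _ := Choice.on Out.
HB.instance Definition _ := EqQuotient.on Out.

Lemma out_eqP a b : \pi_Out a = \pi_Out b <-> inner (a^-1 * b).
Proof. by split=> [/eqmodP/asboolP | ?] //; apply/eqmodP/asboolP. Qed.

Definition out_one : Out := \pi_Out 1.
Definition out_mul (x y : Out) : Out := \pi_Out (repr x * repr y).
Definition out_inv (x : Out) : Out := \pi_Out (repr x)^-1.

Lemma inner_repr a : inner (a^-1 * repr (\pi_Out a)).
Proof. by apply/out_eqP; rewrite reprK. Qed.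

Lemma out_mulE a b : out_mul (\pi_Out a) (\pi_Out b) = \pi_Out (a * b).
Proof.
apply/esym/out_eqP; rewrite invgM.
have := innerM (innerJ b (inner_repr a)) (inner_repr b).
by rewrite !mulgA mulgK.
Qed.

Lemma out_invE a : out_inv (\pi_Out a) = \pi_Out a^-1.
Proof.
apply/out_eqP; rewrite invgK.
by have := innerJ a^-1 (inner_repr a); rewrite invgK !mulgA mulgV mul1g.
Qed.

Lemma out_ind (P : Out -> Prop) : (forall a, P (\pi_Out a)) -> forall x, P x.
Proof. by move=> Pa x; rewrite -[x]reprK. Qed.

Fact out_mulA : associative out_mul.
Proof.
elim/out_ind=> a; elim/out_ind=> b; elim/out_ind=> c.
by rewrite (out_mulE b c) (out_mulE a b) 2!out_mulE mulgA.
Qed.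

Fact out_mul1 : left_id out_one out_mul.
Proof. by elim/out_ind=> a; rewrite out_mulE mul1g. Qed.

Fact out_1mul : right_id out_one out_mul.
Proof. by elim/out_ind=> a; rewrite out_mulE mulg1. Qed.

Fact out_mulV : left_inverse out_one out_inv out_mul.
Proof. by elim/out_ind=> a; rewrite out_invE (out_mulE _ _) mulVg. Qed.

Fact out_Vmul : right_inverse out_one out_inv out_mul.
Proof. by elim/out_ind=> a; rewrite out_invE (out_mulE _ _) mulgV. Qed.

HB.instance Definition _ := isGroup.Build Out
  out_mulA out_mul1 out_1mul out_mulV out_Vmul.

Lemma out_piM : {morph \pi_Out : a b / a * b}.
Proof. by move=> a b; rewrite [RHS]out_mulE. Qed.

End AutGroup.

Section CellularAutomata.
Variables (G : groupType) (A : Type).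
Local Notation config := (G -> A).

Definition shift (g : G) (x : config) : config := fun h => x (g^-1 * h).

Definition restr (S : {fset G}) (x : config) : S -> A := fun s => x (val s).
Arguments restr : clear implicits.

Definition is_ca (tau : config -> config) : Prop :=
  exists (S : {fset G}) (mu : (S -> A) -> A),
    forall x g, tau x g = mu (restr S (shift g^-1 x)).

Record CA := MkCA { ca_fun :> config -> config; ca_funP : is_ca ca_fun }.

HB.instance Definition _ := gen_eqMixin CA.
HB.instance Definition _ := gen_choiceMixin CA.

Lemma ca_eq (s t : CA) : (forall x, s x = t x) -> s = t.
Proof.
case: s t => [f fP] [g gP] /= /funext fg.
case: g / fg gP => gP; congr MkCA; exact: Prop_irrelevance.
Qed.

Lemma is_ca_id : is_ca id.
Proof.
exists [fset 1]%fset, (fun y => y [` fset11 1]%fset) => x g.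
by rewrite /restr /shift /= invgK mulg1.
Qed.

Lemma is_ca_comp (s t : config -> config) :
  is_ca s -> is_ca t -> is_ca (s \o t).
Proof.
move=> [S [mu sE]] [T [nu tE]].
pose U := [fset (a * b)%g | a in S, b in T]%fset.
have inU (a : S) (b : T) : (val a * val b)%g \in U.
  by apply: in_imfset2; exact: valP.
exists U, (fun y => mu (fun a => nu (fun b => y [` inU a b]%fset))) => x g.
rewrite /= sE; congr mu; apply/funext => a; rewrite /restr /shift tE.
by congr nu; apply/funext => b; rewrite /restr /shift /= !invgK mulgA.
Qed.

Definition ca_one : CA := MkCA is_ca_id.
Definition ca_mul (s t : CA) : CA :=
  MkCA (is_ca_comp (ca_funP s) (ca_funP t)).

Fact ca_mulA : associative ca_mul.
Proof. by move=> r s t; apply: ca_eq. Qed.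

Fact ca_mul1 : left_id ca_one ca_mul.
Proof. by move=> s; apply: ca_eq. Qed.

Fact ca_1mul : right_id ca_one ca_mul.
Proof. by move=> s; apply: ca_eq. Qed.

HB.instance Definition _ := isMonoid.Build CA ca_mulA ca_mul1 ca_1mul.

Definition star (phi : G -> G) : config -> config := fun x => x \o phi.

Lemma is_ca_conj (phi : Aut G) (tau : CA) :
  is_ca (star phi^-1 \o tau \o star phi).
Proof.
case: tau => tau [S [mu tauE]] /=.
pose U := [fset phi a | a in S]%fset.
have inU (a : S) : phi (val a) \in U by apply: in_imfset; exact: valP.
exists U, (fun y => mu (fun a => y [` inU a]%fset)) => x g.
rewrite /star /= tauE; congr mu; apply/funext => a.
by rewrite /restr /shift /= !invgK autM autKV.
Qed.

Definition phiCA_fun (phi : Aut G) (tau : CA) : CA :=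
  MkCA (is_ca_conj phi tau).

Lemma phiCA_funE phi (tau : CA) x g :
  phiCA_fun phi tau x g = tau (x \o phi) (phi^-1 g).
Proof. by []. Qed.

Lemma phiCA_morph phi : monoid_morphism (phiCA_fun phi).
Proof.
split=> [|s t]; apply: ca_eq => x; apply/funext => g; rewrite phiCA_funE.
  by rewrite /= autKV.
congr (ca_fun s _ _); apply/funext => h.
by rewrite [RHS]phiCA_funE autVK.
Qed.

Lemma phiCA_K (phi : Aut G) : cancel (phiCA_fun phi) (phiCA_fun phi^-1).
Proof.
move=> s; apply: ca_eq => x; apply/funext => g; rewrite !phiCA_funE invgK autVK.
by congr (ca_fun s _ _); apply/funext => h; rewrite /comp autVK.
Qed.

Lemma phiCA_bij phi : bijective (phiCA_fun phi).
Proof.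
exists (phiCA_fun phi^-1); first exact: phiCA_K.
by rewrite -{2}[phi]invgK; exact: phiCA_K.
Qed.

Definition phiCA (phi : Aut G) : Aut CA :=
  MkAut (phiCA_morph phi) (phiCA_bij phi).

Lemma phiCA_M : {morph phiCA : phi psi / phi * psi}.
Proof.
move=> phi psi; apply: aut_eq => s; apply: ca_eq => x; apply/funext => g.
by rewrite [LHS]phiCA_funE invgM.
Qed.

Definition Psi (phi : Aut G) : Out CA := \pi_(Out CA) (phiCA phi).

Fact Psi_M : {morph Psi : phi psi / phi * psi}.
Proof. by move=> phi psi; rewrite /Psi phiCA_M out_piM. Qed.

HB.instance Definition _ := isMultiplicative.Build (Aut G) (Out CA) Psi Psi_M.

End CellularAutomata.

Arguments CA : clear implicits.
Arguments Psi : clear implicits.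

(* Main.v *)
Require Import Defs.
From mathcomp Require Import all_boot.
From mathcomp Require Import boolp finmap.

Local Open Scope group_scope.

(** Right translation by [h], which sends [x] to [g |-> x (g * h)], is a
    cellular automaton, and these automata form a copy of [G] inside
    [CA G A] as soon as [A] has two elements ([translation_inj]).  On this copy
    the automorphism induced by [phi] acts as [phi] itself
    ([phiCA_translation]).  When [G] is abelian, right translations are also
    left translations, that is, shifts; cellular automata commute with shifts,
    so translations are central ([translation_central]), and inner
    automorphisms fix central elements ([inner_central]).  Hence the class
    modulo inner automorphisms still determines the action on translations,
    and therefore determines [phi]. *)

Lemma inner_central (M : monoidType) (a : Aut M) (x : M) :
  inner a -> (forall y, x * y = y * x) -> a x = x.
Proof.
by move=> [u [v [_ vu aE]]] xC; rewrite aE -xC -mulgA vu mulg1.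
Qed.

Section Translation.
Variables (G : groupType) (A : Type).

Lemma is_ca_translation (h : G) :
  is_ca (fun (x : G -> A) (g : G) => x (g * h)).
Proof.
exists [fset h]%fset, (fun y => y [` fset11 h]%fset) => x g.
by rewrite /restr /shift /= invgK.
Qed.

Definition translation (h : G) : CA G A := MkCA (is_ca_translation h).

(** The value at the identity of the translate by [h] of a configuration is its
    value at [h], so a configuration that singles out [h] tells [h] from [k]. *)
Lemma translation_inj (a0 a1 : A) : a0 <> a1 -> injective translation.
Proof.
move=> a01 h k hk; apply/esym/eqP/negPn/negP => /negbTE kh.
pose x (g : G) := if g == h then a1 else a0.
have : translation h x 1 = translation k x 1 by rewrite hk.
by rewrite /= /x !mul1g eqxx kh => /esym.
Qed.

(** Conjugating by [phi] evaluates [x \o phi] at [phi^-1 g * h], that is, [x] at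
    [g * phi h]. *)
Lemma phiCA_translation (phi : Aut G) (h : G) :
  phiCA A phi (translation h) = translation (phi h).
Proof.
apply: ca_eq => x; apply/funext => g.
by rewrite [LHS]phiCA_funE /= autM autKV.
Qed.

Lemma ca_shift (tau : CA G A) (g : G) (x : G -> A) :
  tau (shift g x) = shift g (tau x).
Proof.
case: tau => tau [S [mu tauE]] /=; apply/funext => k.
rewrite /shift !tauE; congr mu; apply/funext => s.
by rewrite /restr /shift !invgK mulgA.
Qed.

(** In an abelian group, right translation by [h] is the shift by [h^-1], which
    cellular automata commute with because their local rule is the same at
    every cell. *)
Lemma translation_central (hG : forall g h : G, g * h = h * g) (h : G)
    (tau : CA G A) :
  translation h * tau = tau * translation h.
Proof.
have transE x : translation h x = shift h^-1 x.
  by apply/funext => g; rewrite /shift invgK /= hG.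
apply: ca_eq => x.
by rewrite [LHS]transE -ca_shift -transE.
Qed.

End Translation.

Theorem corollary4 (G : groupType) (A : finType)
    (hG : forall g h : G, g * h = h * g) (hA : (2 <= #|A|)%N) :
  injective (Psi G A : {multiplicative Aut G -> Out (CA G A)}).
Proof.
move=> phi psi /out_eqP inn; apply: aut_eq => h.
have /card_gt1P[a0 [a1 [_ _ /eqP a01]]] := hA.
apply: (translation_inj _ _ _ _ a01); rewrite -!phiCA_translation.
have := inner_central _ _ _ inn (translation_central _ _ hG h).
by rewrite autME => {1}<-; rewrite autKV.
Qed.
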